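(* Let $f:\mathbb R^n\to\mathbb R^n$ be a polynomial vector field with $p:=\deg(f)\ge 2$ and $f(0)=0$, and let $h:=p-1$. Let $x_0\in\mathbb R^n$, let $T>0$ be such that $[0,T]$ is contained in the interval of definition of the solution $x(t;x_0)$ of $\dot x=f(x)$, $x(0)=x_0$, and let $R<+\infty$ satisfy $\sup_{t\in[0,T]}\|x(t;x_0)\|_\infty\le R$; put $R_+:=\max(R,1)$. Let $v$, $\epsilon_D$, $C_2$, $\Theta$, $k_D$ be as defined in the context and let $\rho(T):=hC_2\Theta(T)$. Assume $$\rho(T)>1\qquad\text{and}\qquad R\,\rho(T)<1.$$ Then, for all $D\ge1$, $$\sup_{t\in[0,T]}\epsilon_D(t;x_0)\le K_2\,\gamma_2^{\,k_D},$$ where $$\gamma_2:=(R\rho(T))^h,\qquad K_2:=\frac{\|v\|_1\,\rho(T)\,R\,R_+^{h-1}}{\rho(T)-1}.$$ Consequently, $\sup_{t\in[0,T]}\epsilon_D(t;x_0)\to0$ as $D\to+\infty$.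
   Context: Here $\deg(f)=\max_k\deg(f_k)$ (total degree). Write $f(x)=F_1x+f_{\ge2}(x)$, where $F_1=Df(0)$ is the Jacobian of $f$ at $0$ and $(f_{\ge2})_i(x)=\sum_{2\le|\gamma|\le p}c_{i\gamma}x^\gamma$ ($\gamma\in\mathbb N^n$, $|\gamma|=\sum_i\gamma_i$). Set $C_2:=\max_{1\le i\le n}\sum_{2\le|\gamma|\le p}|c_{i\gamma}|$. For a $k\times k$ real matrix $U$, $\mu_\infty(U):=\max_{1\le i\le k}\big(U_{ii}+\sum_{\ell\ne i}|U_{i\ell}|\big)$ (logarithmic norm). Set $\mu_1:=\mu_\infty(F_1)$, $\mu_1^+:=\max(\mu_1,0)$, $\mu_1^-:=\min(\mu_1,0)$, and for $t\in[0,T]$ $$\Theta(t):=\int_0^t e^{(\mu_1^-+h\mu_1^+)s}\,ds .$$ Carleman truncation of degree $D\ge1$: let $\alpha=(\alpha_1,\dots,\alpha_M)^T$ be the vector of all non-constant monomials $x^\beta$ in $x=(x_1,\dots,x_n)$ of total degree at most $D$ (degrees $1,\dots,D$), ordered by nondecreasing total degree. With the Lie derivative $\mathcal L_f(u)=\sum_{j=1}^n\frac{\partial u}{\partial x_j}f_j$ applied componentwise, there are unique constant matrices $A\in\mathbb R^{M\times M}$ and $B$ such that $\mathcal L_f(\alpha)=A\alpha+B\psi$, where $\psi$ is the vector of the monomials of degrees $D+1,\dots,D+p-1$. The observable is $g(x)=v^T\alpha(x)$ with $v\in\mathbb R^M$ supported on degree $1$, meaning $v_j\neq0$ only if $\deg(\alpha_j)=1$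 (so $g$ is a linear form, the same for all $D$, $v$ being padded with zeros). Set $z_D(t;z_0):=e^{At}\alpha(x_0)$ and $$\epsilon_D(t;x_0):=|v^T\alpha(x(t;x_0))-v^Tz_D(t;z_0)|.$$ Support gap: $k_D:=\lceil (D-h)/h\rceil$, equivalently $k_D+1=\lceil D/h\rceil$. $\|v\|_1=\sum_j|v_j|$. *)

(* Defs.v *)
From HB Require Import structures.
From mathcomp Require Import all_boot all_order all_algebra.
From mathcomp Require Import all_classical all_reals all_analysis.
From mathcomp Require mpoly.
(* The notations of mpoly clash with those of analysis. *)
Import -(notations) mpoly.

Set Implicit Arguments.
Unset Strict Implicit.
Unset Printing Implicit Defensive.

Import Order.TTheory GRing.Theory Num.Theory.
Import numFieldNormedType.Exports.

Local Open Scope classical_set_scope.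
Local Open Scope ring_scope.

Section PolynomialVectorFields.
Variables (R : realType) (n : nat).
Implicit Types (f : 'I_n -> mpoly n R) (y : 'cV[R]_n).

Definition peval (q : mpoly n R) y : R := meval (fun i => y i 0) q.

Definition pdeg (q : mpoly n R) : nat := \max_(m <- msupp q) mdeg m.

Definition vf_deg f : nat := \max_(k < n) pdeg (f k).

Definition vf_eval f y : 'cV[R]_n := \col_i peval (f i) y.

Definition lie f (u : mpoly n R) : mpoly n R := \sum_(j < n) mderiv j u * f j.

Definition jacobian0 f : 'M[R]_n := \matrix_(i, j) peval (mderiv j (f i)) 0.

(* The solution need not be the maximal one: by uniqueness it is a restriction
   of it. *)
Definition is_solution f (x0 : 'cV[R]_n) (J : set R) (x : R -> 'cV[R]_n) : Prop :=
  [/\ open J, is_interval J, J 0, x 0 = x0 &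
      forall t, J t -> is_derive t 1 x (vf_eval f (x t))].

(* The index type [bmultinom n p.+1] consists of the gamma with |gamma| <= p;
   all the sums are nonnegative, so 0 is a neutral starting value. *)
Definition C2 f : R :=
  \big[Num.max/0]_(i < n)
    \sum_(g : bmultinom n (vf_deg f).+1 | (2 <= mdeg (g : multinom n))%N)
      `|mcoeff (g : multinom n) (f i)|.

End PolynomialVectorFields.

(* The values may all be negative, so the maximum starts from one of them. *)
Definition log_norm_inf (R : realType) (k : nat) (U : 'M[R]_k.+1) : R :=
  let r i := U i i + \sum_(l < k.+1 | l != i) `|U i l| in
  \big[Num.max/r ord0]_(i < k.+1) r i.

Section Rates.
Variables (R : realType) (n : nat) (f : 'I_n.+1 -> mpoly n.+1 R).

Let h : nat := (vf_deg f).-1.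

Definition mu1 : R := log_norm_inf (jacobian0 f).
Definition mu1_pos : R := Num.max mu1 0.
Definition mu1_neg : R := Num.min mu1 0.

Definition Theta (t : R) : R :=
  \int[lebesgue_measure]_(s in `[0, t]) expR ((mu1_neg + h%:R * mu1_pos) * s).

Definition rho (T : R) : R := h%:R * C2 f * Theta T.

End Rates.

Section Carleman.
Variables (R : realType) (n : nat) (f : 'I_n -> mpoly n R).

Definition enumerates_degrees (a b N : nat) (e : 'I_N -> multinom n) : Prop :=
  injective e /\ forall m, (exists i, e i = m) <-> (a <= mdeg m <= b)%N.

(* The order of the monomials of equal degree in [alpha] is left free; once
   [alpha] and [psi] are chosen, [lie_alpha] determines [cA] and [cB], and they
   exist as soon as f vanishes at 0. *)
Record carleman (D : nat) := Carleman {
  cdim : nat;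
  rdim : nat;
  alpha : 'I_cdim -> multinom n;
  psi : 'I_rdim -> multinom n;
  alpha_enum : enumerates_degrees 1 D alpha;
  alpha_sorted : forall i j : 'I_cdim, (i <= j)%N ->
    (mdeg (alpha i) <= mdeg (alpha j))%N;
  psi_enum : enumerates_degrees D.+1 (D + (vf_deg f).-1) psi;
  cA : 'M[R]_cdim;
  cB : 'M[R]_(cdim, rdim);
  lie_alpha : forall i, lie f (@mpolyX _ R (alpha i)) =
    \sum_j cA i j *: @mpolyX _ R (alpha j) +
    \sum_l cB i l *: @mpolyX _ R (psi l) }.

Definition alpha_eval D (C : carleman D) (y : 'cV[R]_n) : 'cV[R]_(cdim C) :=
  \col_i peval (@mpolyX _ R (alpha i)) y.

Definition supported_on_degree1 D (C : carleman D) (v : 'cV[R]_(cdim C)) : Prop :=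
  forall j, v j 0 != 0 -> mdeg (alpha j) = 1%N.

Definition observable D (C : carleman D) (v : 'cV[R]_(cdim C)) : mpoly n R :=
  \sum_j v j 0 *: @mpolyX _ R (alpha j).

End Carleman.

Definition expmx (R : realType) (k : nat) (U : 'M[R]_k) : 'M[R]_k :=
  limn (series (fun i : nat => (i`!%:R)^-1 *: U ^+ i)).

Definition dotv (R : realType) (k : nat) (v w : 'cV[R]_k) : R := (v^T *m w) 0 0.

Definition norm1 (R : realType) (k : nat) (v : 'cV[R]_k) : R := \sum_j `|v j 0|.

Section TruncationError.
Variables (R : realType) (n : nat) (f : 'I_n -> mpoly n R) (D : nat).
Variables (C : carleman f D) (v : 'cV[R]_(cdim C)).

Definition carleman_sol (x0 : 'cV[R]_n) (t : R) : 'cV[R]_(cdim C) :=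
  expmx (t *: cA C) *m alpha_eval C x0.

Definition trunc_error (x : R -> 'cV[R]_n) (x0 : 'cV[R]_n) (t : R) : R :=
  `|dotv v (alpha_eval C (x t)) - dotv v (carleman_sol x0 t)|.

End TruncationError.

(* Extended-real supremum: it is +oo when F is unbounded on [0, T]. *)
Definition sup_on (R : realType) (T : R) (F : R -> R) : \bar R :=
  ereal_sup [set (F t)%:E | t in `[0, T]].

Definition support_gap (R : realType) (D h : nat) : int :=
  Num.ceil ((D%:R - h%:R) / h%:R : R).

(* Main.v *)
Require Import Defs.
From HB Require Import structures.
From mathcomp Require Import all_boot all_order all_algebra.
From mathcomp Require Import all_classical all_reals all_analysis.
From mathcomp Require mpoly.
Import -(notations) mpoly.
From mathcomp.multinomials Require ssrcomplements.
From mathcomp Require Import ring lra.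

(** The error of the Carleman truncation is bounded by following, for every
    monomial [m], the difference [gap m] between its value along the exact
    solution and the corresponding coordinate of the truncated linear system,
    where the monomials of degree above [D] have truncated coordinate 0. For
    [mdeg m <= D] the gap starts at 0 and its derivative is the linear functional
    [m' |-> gap m'] applied to the Lie derivative of the monomial [m]
    ([is_derive_gap]); for [mdeg m > D] the gap is the monomial itself, of size at
    most [r ^+ D.+1] since the hypotheses force [r < 1].

    Put [k = mdeg m] and [h = deg f - 1]. The Lie derivative of [m] has a part of
    degree [k], whose logarithmic norm is at most [k * mu1], and a part of degrees
    [k + 1] to [k + h], with coefficients of total size at most [k * C2]
    ([monomial_ext_lie_le]). A first-touching-time argument
    ([persistent_positivity]) then shows that the gaps of degree [k] stay below
    [H_k] whenever
    [H_k' >= k * mu1 * H_k + k * C2 * max_(k < l <= k + h) H_l] for [k <= D] and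
    [H_l >= r ^+ D.+1] for [l > D] ([gap_le]).

    Such [H_k] are obtained by counting the ways to climb from degree [k] above
    degree [D] according to the number [j] of jumps. After [i] jumps the degree
    lies between [k + i] and [k + i * h], so the product of the jump rates is at
    most [C2 ^+ j] times the product of the [k + i * h] for [i < j], while the
    exponential weights integrate to
    [\int_0^t expR (k * mu1 * s) * Theta s ^+ (j - 1) / (j - 1)! ds]. These
    functions satisfy an exact backward equation ([exit_densityE]), which gives
    the required inequality ([majorant_slopeE], [majorant_le_jump]). For [k = 1]
    the term with [j] jumps is at most
    [(h * C2 * Theta) ^+ j = rho ^+ j] ([majorant1_le]), and [j <= D] because each
    jump raises the degree.

    A linear observable therefore has an error of at most
    [norm1 v * r ^+ D.+1 * \sum_(1 <= j <= D) rho ^+ j], that is, at most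
    [norm1 v * (r * rho) ^+ D.+1 / (rho - 1)]. This tends to 0 because
    [r * rho < 1], and it implies the announced bound because
    [h * k_D < D], where [k_D] is the support gap. *)

Set Implicit Arguments.
Unset Strict Implicit.
Unset Printing Implicit Defensive.

Import Order.TTheory GRing.Theory Num.Theory.
Import numFieldNormedType.Exports.

Local Open Scope classical_set_scope.
Local Open Scope ring_scope.

(** * Calculus on an interval *)

Section Calculus.
Variable R : realType.
Implicit Types (f df g : R -> R) (t T : R).

Lemma le_of_derive f df g dg T :
  (forall t, 0 <= t <= T -> is_derive t 1 f (df t)) ->
  (forall t, 0 <= t <= T -> is_derive t 1 g (dg t)) ->
  (forall t, 0 <= t <= T -> df t <= dg t) -> f 0 <= g 0 ->
  forall t, 0 <= t <= T -> f t <= g t.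
Proof.
move=> fd gd dle le0 t tT.
pose u s := g s - f s.
have ud s : 0 <= s <= T -> is_derive s 1 u (dg s - df s).
  by move=> sT; apply: is_deriveB; [exact: gd|exact: fd].
suff : u 0 <= u t by rewrite /u; lra.
have [t0 tT'] := andP tT.
apply: (@ger0_derive1_ndecr R u 0 t) => //.
- move=> s; rewrite in_itv/= => /andP[s0 st].
  by have [] := ud s ltac:(by rewrite (ltW s0) (le_trans (ltW st))).
- move=> s; rewrite in_itv/= => /andP[s0 st].
  have sT : 0 <= s <= T by rewrite (ltW s0) (le_trans (ltW st)).
  by rewrite derive1E (@derive_val _ _ _ _ _ _ _ (ud s sT)) subr_ge0 dle.
- apply: derivable_within_continuous => s; rewrite in_itv/= => /andP[s0 st].
  by have [] := ud s ltac:(by rewrite s0 (le_trans st)).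
Qed.

Lemma ge0_of_derive f df T : (forall t, 0 <= t <= T -> is_derive t 1 f (df t)) ->
  (forall t, 0 <= t <= T -> 0 <= df t) -> 0 <= f 0 ->
  forall t, 0 <= t <= T -> 0 <= f t.
Proof.
by move=> fd df0 f0; apply: (@le_of_derive (fun=> 0) (fun=> 0) f df T).
Qed.

(** The base point is -1 and the integrand is frozen at [g 0] on the negative
    side: the primitive then has a two-sided derivative at 0 as soon as [g] is
    continuous on the nonnegative half-line. *)
Definition primitive g t : R :=
  \int[lebesgue_measure]_(s in `[-1, t]) g (Num.max 0 s) -
  \int[lebesgue_measure]_(s in `[-1, 0]) g (Num.max 0 s).

Lemma primitive0 g : primitive g 0 = 0.
Proof. by rewrite /primitive subrr. Qed.

Lemma primitive_derive g t : (forall s, 0 <= s -> {for s, continuous g}) ->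
  0 <= t -> is_derive t 1 (primitive g) (g t).
Proof.
move=> gc t0.
pose g0 s := g (Num.max 0 s).
have g0c : continuous g0.
  move=> s; apply: (@continuous_comp _ _ _ (Num.max (0 : R)) g).
    by apply: continuous_max; [exact: cvg_cst|exact: cvg_id].
  by apply: gc; rewrite le_max lexx.
have [||||dF F'] := @continuous_FTC1_closed R g0 (-1) t (t + 1).
- by rewrite ltrDl.
- apply: continuous_compact_integrable; first exact: segment_compact.
  exact: continuous_subspaceT.
- lra.
- exact: g0c.
have H : is_derive t 1
    (fun x => \int[lebesgue_measure]_(s in `[-1, x]) g0 s) (g0 t).
  by apply: DeriveDef; [exact: dF|rewrite -derive1E F'].
rewrite -{2}(max_r t0) -[X in is_derive _ _ _ X]subr0.
exact: (is_deriveB H (is_derive_cst _ _ _)).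
Qed.

Lemma integral_primitive g t : (forall s, 0 <= s -> {for s, continuous g}) ->
  0 <= t -> \int[lebesgue_measure]_(s in `[0, t]) g s = primitive g t.
Proof.
move=> gc; rewrite le_eqVlt => /predU1P[<-|t0].
  by rewrite primitive0 set_itv1 Rintegral_set1.
have dP s : 0 <= s <= t -> is_derive s 1 (primitive g) (g s).
  by case/andP => s0 _; exact: primitive_derive.
have cP s : 0 <= s <= t -> {for s, continuous (primitive g)}.
  by move=> /dP[+ _]; move/derivable1_diffP/differentiable_continuous.
rewrite /Rintegral (@continuous_FTC2 R g (primitive g) 0 t)//.
- by rewrite primitive0 sube0.
- apply: continuous_in_subspaceT => s; rewrite inE/= in_itv/= => /andP[s0 _].
  exact: gc.
- split.
  + move=> s; rewrite in_itv/= => /andP[s0 st].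
    by have [] := dP s ltac:(by rewrite !ltW).
  + by apply: cvg_at_right_filter; apply: cP; rewrite lexx ltW.
  + by apply: cvg_at_left_filter; apply: cP; rewrite lexx ltW.
- move=> s; rewrite in_itv/= => /andP[s0 st].
  by rewrite derive1E; have [] := dP s ltac:(by rewrite !ltW).
Qed.

Lemma derive_expRM (c : R) t :
  is_derive t 1 (fun s => expR (c * s)) (c * expR (c * t)).
Proof.
have H : is_derive t 1 (fun s : R => c * s) c.
  by apply: is_derive_eq; rewrite [c *: 1]mulr1.
have := @is_derive1_comp R expR (fun s => c * s) t _ _ (is_derive_expR _) H.
by rewrite mulrC.
Qed.

Lemma derivable_continuous_at g t (dg : R) :
  is_derive t 1 g dg -> {for t, continuous g}.
Proof. by case; move/derivable1_diffP/differentiable_continuous. Qed.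

(** A finite family that is positive at 0 cannot reach zero: at the first time
    one member vanishes, all members are still nonnegative and that member has
    just come down to zero, so its derivative is at most 0. *)
Lemma persistent_positivity (I : finType) (u du : I -> R -> R) T :
  (forall i t, 0 <= t <= T -> is_derive t 1 (u i) (du i t)) ->
  (forall i, 0 < u i 0) ->
  (forall i t, 0 <= t <= T -> (forall j, 0 <= u j t) -> u i t = 0 ->
    0 < du i t) ->
  forall i t, 0 <= t <= T -> 0 < u i t.
Proof.
move=> ud u0 upos.
have uc i t : 0 <= t <= T -> {for t, continuous (u i)}.
  by move=> /(ud i)[+ _]; move/derivable1_diffP/differentiable_continuous.
suff H : ~ exists t, 0 <= t <= T /\ exists i, u i t <= 0.
  move=> i t tT; rewrite ltNge; apply/negP => uit.
  by apply: H; exists t; split => //; exists i.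
move=> [t1 [t1T ex1]].
pose S := [set t | 0 <= t <= T /\ exists i, u i t <= 0].
have hS : has_inf S.
  by split; [exists t1|exists 0 => t [/andP[]]].
pose s := inf S.
have s0 : 0 <= s by apply: lb_le_inf; [exists t1|move=> t [/andP[]]].
have st1 : s <= t1 by apply: ge_inf; [case: hS|].
have sT : 0 <= s <= T by rewrite s0 (le_trans st1)//; case/andP: t1T.
(* [s] is the first time at which some member is nonpositive. *)
have before t : 0 <= t < s -> forall i, 0 < u i t.
  move=> /andP[t0 ts] i; rewrite ltNge; apply/negP => uit.
  have : s <= t.
    apply: ge_inf; [by case: hS|split; last by exists i].
    by rewrite t0 (le_trans (ltW ts))//; case/andP: sT.
  by rewrite leNgt ts.
have [i uis] : exists i, u i s <= 0.
  apply: contrapT => /forallNP nex.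
  have nr : \forall t \near s, forall i, 0 < u i t.
    apply: (@filter_forall R I (fun i t => 0 < u i t) (nbhs s) _) => i.
    have : 0 < u i s by rewrite ltNge; apply/negP/nex.
    by move=> us; exact: cvgr_gt (uc i s sT) _ us.
  have [e /= e0 He] := (nbhs_ballP _ _).1 nr.
  have [t [tT [i uit]] ts] := inf_adherent e0 hS.
  have st : s <= t by apply: ge_inf; [case: hS|split => //; exists i].
  have /(_ i) := He t ltac:(by rewrite /ball/= distrC ger0_norm ?subr_ge0// ltrBlDl).
  by rewrite ltNge uit.
have sgt0 : 0 < s.
  rewrite lt_neqAle s0 andbT; apply/eqP => s0'.
  by move: uis; rewrite -s0' leNgt u0.
have ge_s j : 0 <= u j s.
  rewrite leNgt; apply/negP => ujs.
  have nr : \forall t \near s, u j t < 0 by exact: cvgr_lt (uc j s sT) _ ujs.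
  have [e /= e0 He] := (nbhs_ballP _ _).1 nr.
  pose d := Num.min (e / 2) s.
  have d0 : 0 < d by rewrite lt_min sgt0 divr_gt0.
  have := He (s - d).
  rewrite /ball/= opprB addrC subrK gtr0_norm//.
  have -> : d < e by rewrite gt_min; apply/orP; left; lra.
  move=> /(_ isT); apply/negP; rewrite -leNgt ltW// before// ltrBlDr ltrDl d0 andbT.
  by rewrite subr_ge0 ge_min lexx orbT.
have uis0 : u i s = 0 by apply/eqP; rewrite eq_le uis ge_s.
have dpos := upos i s sT ge_s uis0.
have [dv dE] := ud i s sT.
have cv : h^-1 *: (u i (h + s) - u i s) @[h --> 0^'] --> du i s.
  have E : (fun h : R => h^-1 *: (u i (h *: 1 + s) - u i s)) =
           (fun h : R => h^-1 *: (u i (h + s) - u i s)).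
    by apply/funext => h; rewrite [h *: 1]mulr1.
  by move: dv; rewrite /derivable -dE /derive E.
have nr : \forall h \near 0^', 0 < h^-1 *: (u i (h + s) - u i s).
  by exact: cvgr_gt cv _ dpos.
have [e /= e0 He] := (nbhs_ballP _ _).1 nr.
pose d := Num.min (e / 2) s.
have d0 : 0 < d by rewrite lt_min sgt0 divr_gt0.
have := He (- d).
rewrite /ball/= sub0r opprK gtr0_norm//.
have -> : d < e by rewrite gt_min; apply/orP; left; lra.
rewrite oppr_eq0 gt_eqF// => /(_ isT isT).
rewrite uis0 subr0 invrN scaleNr oppr_gt0 pmulr_rlt0 ?invr_gt0//.
apply/negP; rewrite -leNgt ltW// before// addrC ltrBlDr ltrDl d0 andbT.
by rewrite subr_ge0 ge_min lexx orbT.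
Qed.

End Calculus.

(** * Sums *)

Lemma le_sum_widen (R : numDomainType) (a b : nat) (F G : nat -> R) :
  (a <= b)%N -> (forall j, (j < a)%N -> F j <= G j) ->
  (forall j, (j < b)%N -> 0 <= G j) ->
  \sum_(j < a) F j <= \sum_(j < b) G j.
Proof.
move=> ab FG G0; rewrite (big_ord_widen b F)// big_mkcond/=.
by apply: ler_sum => j _; case: ifPn => [/FG//|_]; exact: G0.
Qed.

(** The sum is [(q ^+ D.+1 - q) / (q - 1)]. *)
Lemma geometric_sum_le (R : realFieldType) (q : R) (D : nat) : 1 < q ->
  \sum_(j < D) q ^+ j.+1 <= q ^+ D.+1 / (q - 1).
Proof.
move=> q1; rewrite ler_pdivlMr ?subr_gt0//.
have -> : \sum_(j < D) q ^+ j.+1 = q * \sum_(j < D) q ^+ j.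
  by rewrite mulr_sumr; apply: eq_bigr => j _; rewrite exprS.
rewrite -mulrA [_ * (q - 1)]mulrC -subrX1 mulrBr mulr1 -exprS gerBl.
by rewrite (le_trans ler01)// ltW.
Qed.

(** * A supersolution counted by jumps *)

Section Majorant.
Variables (R : realType) (mu C : R) (h D : nat).
Hypotheses (h_gt0 : (0 < h)%N) (C_ge0 : 0 <= C).
Implicit Types (t : R) (j k l : nat).

(** After [i] jumps, a path that starts at degree [k] has a degree between [k + i]
    and [k + i * h]. As the growth rate in degree [l] is [l * mu], the lower end is
    the worst case if [mu <= 0] and the upper end otherwise: the worst path climbs
    by [stride] at each jump. *)
Definition stride : nat := if mu <= 0 then 1%N else h.

Definition growth : R := stride%:R * mu.

Definition theta : R -> R := primitive (fun s => expR (growth * s)).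

Lemma theta_derive t : 0 <= t -> is_derive t 1 theta (expR (growth * t)).
Proof.
by apply: primitive_derive => s _; exact: derivable_continuous_at (derive_expRM _ _).
Qed.

Lemma theta0 : theta 0 = 0. Proof. exact: primitive0. Qed.

Lemma theta_ge0 t : 0 <= t -> 0 <= theta t.
Proof.
move=> t0; apply: (@ge0_of_derive R theta (fun s => expR (growth * s)) t).
- by move=> s /andP[s0 _]; exact: theta_derive.
- by move=> s _; exact: expR_ge0.
- by rewrite theta0 lexx.
- by rewrite lexx t0.
Qed.

Lemma theta_le t T : 0 <= t <= T -> theta t <= theta T.
Proof.
move=> /andP[t0 tT].
pose g s := theta (t + s).
have gd s : 0 <= s <= T - t -> is_derive s 1 g (expR (growth * (t + s))).
  move=> /andP[s0 _].
  have H : is_derive s 1 (fun s : R => t + s) 1.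
    rewrite -[X in is_derive _ _ _ X]add0r.
    exact: (is_deriveD (is_derive_cst _ _ _) (is_derive_id _ _)).
  have := @is_derive1_comp R theta (fun s => t + s) s _ _
    (theta_derive (addr_ge0 t0 s0)) H.
  by rewrite mulr1.
have -> : theta T = g (T - t) by rewrite /g addrC subrK.
have cd s : 0 <= s <= T - t -> is_derive s 1 (fun=> theta t) 0.
  by move=> _; exact: is_derive_cst.
apply: (le_of_derive cd gd).
- by move=> s _; exact: expR_ge0.
- by rewrite /g addr0.
- by rewrite lexx subr_ge0 tT.
Qed.

(** Up to the jump rates, this is the weight of the worst paths from degree [k]
    that make their last jump at time [t] after [j] earlier ones. An earlier jump
    at time [s] adds [stride] to the degree for the duration [t - s]; the integral
    over the [j] ordered jump times is therefore [theta t ^+ j / j!]. *)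
Definition exit_density k j t : R :=
  expR (k%:R * mu * t) * theta t ^+ j * (j`!%:R)^-1.

Lemma exit_density_ge0 k j t : 0 <= t -> 0 <= exit_density k j t.
Proof.
by move=> t0; rewrite !mulr_ge0 ?expR_ge0 ?exprn_ge0 ?theta_ge0// invr_ge0.
Qed.

Lemma exit_density0_derive k t :
  is_derive t 1 (exit_density k 0) (k%:R * mu * exit_density k 0 t).
Proof.
have -> : exit_density k 0 = fun s => expR (k%:R * mu * s).
  by apply/funext => s; rewrite /exit_density expr0 fact0 invr1 !mulr1.
exact: derive_expRM.
Qed.

Lemma exit_densityS_derive k j t : 0 <= t ->
  is_derive t 1 (exit_density k j.+1)
    (k%:R * mu * exit_density k j.+1 t + exit_density (k + stride) j t).
Proof.
move=> t0.
have He := derive_expRM (k%:R * mu) t.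
have Ht := @is_deriveX R R theta j.+1 t 1 _ (theta_derive t0).
have H := is_deriveM (is_deriveM He Ht) (is_derive_cst ((j.+1)`!%:R^-1 : R) t 1).
rewrite [X in is_derive _ _ X](_ : _ =
    (fun s => expR (k%:R * mu * s)) * theta ^+ j.+1 *
    cst ((j.+1)`!%:R^-1)); last first.
  by apply/funext => s; rewrite /exit_density 2![in RHS]mulrfctE exprfctE.
apply: (is_derive_eq H).
rewrite exprfctE /exit_density natrD mulrDl mulrDl expRD -/growth /GRing.scale/=.
rewrite mulr0 add0r factS natrM invfM exprS.
have : j.+1%:R != 0 :> R by rewrite pnatr_eq0.
have : j`!%:R != 0 :> R by rewrite pnatr_eq0 -lt0n fact_gt0.
move: (j`!%:R) (j.+1%:R) => b a b0 a0.
by field; rewrite a0 b0.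
Qed.

Lemma exit_density_continuous k j t : 0 <= t ->
  {for t, continuous (exit_density k j)}.
Proof.
move=> t0; case: j => [|j].
  exact: derivable_continuous_at (exit_density0_derive k t).
exact: derivable_continuous_at (exit_densityS_derive k j t0).
Qed.

Definition exit_integral k j : R -> R := primitive (exit_density k j).

Lemma exit_integral_derive k j t : 0 <= t ->
  is_derive t 1 (exit_integral k j) (exit_density k j t).
Proof. by apply: primitive_derive => s s0; exact: exit_density_continuous. Qed.

Lemma exit_integral0 k j : exit_integral k j 0 = 0. Proof. exact: primitive0. Qed.

Lemma exit_integral_ge0 k j t : 0 <= t -> 0 <= exit_integral k j t.
Proof.
move=> t0; apply: (@ge0_of_derive R (exit_integral k j) (exit_density k j) t).
- by move=> s /andP[s0 _]; exact: exit_integral_derive.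
- by move=> s /andP[s0 _]; exact: exit_density_ge0.
- by rewrite exit_integral0.
- by rewrite lexx t0.
Qed.

Lemma exit_integral_le k l j t : 0 <= t -> k%:R * mu <= l%:R * mu ->
  exit_integral k j t <= exit_integral l j t.
Proof.
move=> t0 kl; apply: (@le_of_derive R _ (exit_density k j) _ (exit_density l j) t).
- by move=> s /andP[s0 _]; exact: exit_integral_derive.
- by move=> s /andP[s0 _]; exact: exit_integral_derive.
- move=> s /andP[s0 _]; rewrite /exit_density ler_wpM2r ?invr_ge0// ler_wpM2r//.
    by rewrite exprn_ge0 ?theta_ge0.
  by rewrite ler_expR ler_wpM2r.
- by rewrite !exit_integral0.
- by rewrite lexx t0.
Qed.

(** The number of jumps is [j]; without any jump the path is already above the
    cutoff and has weight 1. *)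
Definition exit_weight k j t : R := if j is j'.+1 then exit_integral k j' t else 1.

(** Both sides solve the same initial value problem. Read from left to right, this
    is the backward equation: the exit integral grows at rate [k * mu] and is fed
    by the paths that have one jump less to make from the next degree. *)
Lemma exit_densityE k j t : 0 <= t ->
  exit_density k j t =
    k%:R * mu * exit_integral k j t + exit_weight (k + stride) j t.
Proof.
move=> t0.
have lhs s : 0 <= s <= t ->
    is_derive s 1 (exit_density k j) (k%:R * mu * exit_density k j s +
      (if j is j'.+1 then exit_density (k + stride) j' s else 0)).
  move=> /andP[s0 _]; case: j => [|j]; last exact: exit_densityS_derive.
  by rewrite addr0; exact: exit_density0_derive.
have rhs s : 0 <= s <= t ->
    is_derive s 1
     (fun t => k%:R * mu * exit_integral k j t + exit_weight (k + stride) j t)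
     (k%:R * mu * exit_density k j s +
      (if j is j'.+1 then exit_density (k + stride) j' s else 0)).
  move=> /andP[s0 _].
  have H1 := is_deriveZ (k%:R * mu) (exit_integral_derive k j s0).
  have H2 : is_derive s 1 (exit_weight (k + stride) j)
      (if j is j'.+1 then exit_density (k + stride) j' s else 0).
    by case: j {lhs H1} => [|j]; [exact: is_derive_cst|exact: exit_integral_derive].
  exact: (is_deriveD H1 H2).
have E0 : exit_density k j 0 =
    k%:R * mu * exit_integral k j 0 + exit_weight (k + stride) j 0.
  rewrite /exit_density exit_integral0 !mulr0 expR0 mul1r add0r theta0.
  by case: j {lhs rhs} => [|j] /=; rewrite ?expr0 ?fact0 ?invr1 ?mulr1//
    expr0n mul0r exit_integral0.
apply/eqP; rewrite eq_le; apply/andP; split.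
- by apply: (le_of_derive lhs rhs) => //; rewrite ?E0 ?lexx ?t0.
- by apply: (le_of_derive rhs lhs) => //; rewrite ?E0 ?lexx ?t0.
Qed.

Definition jump_rates k j : nat := \prod_(i < j) (k + i * h).

Lemma jump_ratesS k j : jump_rates k j.+1 = (k * jump_rates (k + h) j)%N.
Proof.
rewrite /jump_rates big_ord_recl mul0n addn0; congr muln.
by apply: eq_bigr => i _; rewrite -addnA.
Qed.

Lemma leq_jump_rates k l j : (k <= l)%N -> (jump_rates k j <= jump_rates l j)%N.
Proof. by move=> kl; apply: leq_prod => i _; rewrite leq_add2r. Qed.

(** [1 + i * h <= h * i.+1] for every factor. *)
Lemma jump_rates1_le j : (jump_rates 1 j <= h ^ j * j`!)%N.
Proof.
rewrite /jump_rates; elim: j => [|j IH]; first by rewrite big_ord0 muln_gt0.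
rewrite big_ord_recr /= expnSr factS [(j.+1 * _)%N]mulnC mulnACA leq_mul//.
by rewrite mulnC mulnS addnC [leqRHS]addnC leq_add2l.
Qed.

(** A bound for the weight of all the ways to climb from degree [l] above degree
    [D], summed over the number of jumps; as a jump raises the degree by at least
    1, there are at most [D.+1 - l] of them. *)
Definition majorant l t : R := (D < l)%N%:R +
  \sum_(j < D.+1 - l) (jump_rates l j.+1)%:R * C ^+ j.+1 * exit_integral l j t.

(** A common bound for all the degrees that one jump from [k] can reach: the jump
    rates are those of [k + h], the number of jumps is the one allowed by [k.+1],
    and the growth rate [(k + stride) * mu] is the largest one among them. *)
Definition jump_majorant k t : R :=
  \sum_(j < D.+1 - k)
    (jump_rates (k + h) j)%:R * C ^+ j * exit_weight (k + stride) j t.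

Definition majorant_slope k t : R :=
  \sum_(j < D.+1 - k) (jump_rates k j.+1)%:R * C ^+ j.+1 * exit_density k j t.

Lemma majorant_derive l t : 0 <= t ->
  is_derive t 1 (majorant l) (majorant_slope l t).
Proof.
move=> t0; rewrite -[majorant_slope l t]add0r.
rewrite [X in is_derive _ _ X](_ : _ = cst (D < l)%N%:R + \sum_(j < D.+1 - l)
    (((jump_rates l j.+1)%:R * C ^+ j.+1) *: exit_integral l j)); last first.
  by apply/funext => s; rewrite /majorant addrfctE/= fct_sumE.
apply: is_deriveD; apply: is_derive_sum => j; apply: is_deriveZ.
exact: exit_integral_derive.
Qed.

Lemma majorant_slopeE k t : (k <= D)%N -> 0 <= t ->
  majorant_slope k t = k%:R * mu * majorant k t + k%:R * C * jump_majorant k t.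
Proof.
move=> kD t0; rewrite /majorant ltnNge kD add0r.
rewrite !mulr_sumr -big_split/=; apply: eq_bigr => j _.
rewrite exit_densityE// [in LHS]jump_ratesS [in RHS]jump_ratesS natrM exprS.
ring.
Qed.

Lemma majorant_ge0 l t : 0 <= t -> 0 <= majorant l t.
Proof.
move=> t0; rewrite addr_ge0// sumr_ge0// => j _.
by rewrite !mulr_ge0 ?exprn_ge0 ?exit_integral_ge0.
Qed.

Lemma majorant_over l t : (D < l)%N -> majorant l t = 1.
Proof.
move=> lD; rewrite /majorant lD.
by move: lD; rewrite -subn_eq0 => /eqP->; rewrite big_ord0 addr0.
Qed.

Lemma mu_le_growth : mu <= growth.
Proof.
rewrite /growth /stride; case: (leP mu 0) => mu0; first by rewrite mulr1n mul1r.
by rewrite ler_peMl ?ler1n// ltW.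
Qed.

Lemma mulmu_stride k l : (k < l <= k + h)%N ->
  l%:R * mu <= (k + stride)%:R * mu.
Proof.
rewrite /stride => /andP[kl lkh]; case: (leP mu 0) => mu0.
  by apply: ler_wnM2r => //; rewrite ler_nat addn1.
by apply: ler_wpM2r; [exact: ltW|rewrite ler_nat].
Qed.

Lemma majorant_le_jump k l t : (k <= D)%N -> (k < l <= k + h)%N -> 0 <= t ->
  majorant l t <= jump_majorant k t.
Proof.
move=> kD /[dup] /mulmu_stride lmu /andP[kl lkh] t0.
have ge0 j : 0 <= (jump_rates (k + h) j)%:R * C ^+ j * exit_weight (k + stride) j t.
  rewrite !mulr_ge0 ?exprn_ge0//; case: j => [|j] //=; exact: exit_integral_ge0.
rewrite /jump_majorant subSn// big_ord_recl /= {1}/jump_rates big_ord0 expr0 !mulr1.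
have [lD|lD] := ltnP D l.
  by rewrite majorant_over// lerDl sumr_ge0// => j _; exact: ge0.
rewrite /majorant ltnNge lD add0r.
apply: ler_wpDl => //.
pose G j := (jump_rates (k + h) j.+1)%:R * C ^+ j.+1 * exit_integral (k + stride) j t.
apply: (le_sum_widen (G := G) (F := fun j =>
  (jump_rates l j.+1)%:R * C ^+ j.+1 * exit_integral l j t)) => [|j _|j _].
- by rewrite subSn// ltn_sub2l ?(leq_trans kl).
- rewrite ler_pM ?mulr_ge0 ?exprn_ge0 ?exit_integral_ge0 ?ler_wpM2r ?exprn_ge0//.
    by rewrite ler_nat leq_jump_rates.
  exact: exit_integral_le.
- exact: (ge0 j.+1).
Qed.

(** The derivative of [theta ^+ j.+1 / (j.+1)!] is
    [expR (growth * t) * theta ^+ j / j!], and [mu <= growth]. *)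
Lemma exit_integral1_le j t : 0 <= t ->
  exit_integral 1 j t <= theta t ^+ j.+1 / (j.+1)`!%:R.
Proof.
move=> t0.
pose g s : R := theta s ^+ j.+1 / (j.+1)`!%:R.
have gd s : 0 <= s <= t ->
    is_derive s 1 g (expR (growth * s) * theta s ^+ j / j`!%:R).
  move=> /andP[s0 _].
  have H := is_deriveZ ((j.+1)`!%:R^-1 : R)
    (@is_deriveX R R theta j.+1 s 1 _ (theta_derive s0)).
  rewrite (_ : g = ((j.+1)`!%:R^-1 : R) *: theta ^+ j.+1); last first.
    by apply/funext => x; rewrite /g mulrC scalrfctE exprfctE.
  apply: (is_derive_eq H).
  rewrite /GRing.scale/= factS natrM invfM.
  have : j.+1%:R != 0 :> R by rewrite pnatr_eq0.
  have : j`!%:R != 0 :> R by rewrite pnatr_eq0 -lt0n fact_gt0.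
  move: (j`!%:R) (j.+1%:R) => b a b0 a0.
  by field; rewrite a0 b0.
have kd s : 0 <= s <= t -> is_derive s 1 (exit_integral 1 j) (exit_density 1 j s).
  by move=> /andP[s0 _]; exact: exit_integral_derive.
apply: (le_of_derive kd gd).
- move=> s /andP[s0 _]; rewrite /exit_density mulr1n mul1r ler_wpM2r ?invr_ge0// ler_wpM2r//.
    by rewrite exprn_ge0 ?theta_ge0.
  by rewrite ler_expR ler_wpM2r ?mu_le_growth.
- by rewrite exit_integral0 /g theta0 exprS !mul0r.
- by rewrite lexx t0.
Qed.

Lemma majorant1_le t T : (0 < D)%N -> 0 <= t <= T ->
  majorant 1 t <= \sum_(j < D) (h%:R * C * theta T) ^+ j.+1.
Proof.
move=> D0 /[dup] /theta_le tT /andP[t0 /(le_trans t0) T0].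
rewrite /majorant ltnNge D0 add0r subSS subn0.
apply: ler_sum => j _.
rewrite !exprMn -mulrA mulrCA [X in _ <= X * _]mulrC -[leRHS]mulrA.
rewrite ler_wpM2l ?exprn_ge0//.
apply: (@le_trans _ _ ((h ^ j.+1 * (j.+1)`!)%:R * (theta t ^+ j.+1 / (j.+1)`!%:R))).
  by rewrite ler_pM ?exit_integral_ge0 ?exit_integral1_le// ler_nat jump_rates1_le.
rewrite natrM mulrA mulrAC mulfK ?pnatr_eq0 -?lt0n ?fact_gt0// natrX.
by rewrite ler_wpM2l ?exprn_ge0// lerXn2r// nnegrE ?theta_ge0.
Qed.

End Majorant.

(** * Lie derivatives of polynomials *)

Section Polynomials.
Variables (R : realType) (n : nat).
Implicit Types (q : mpoly n R) (m : multinom n) (w : multinom n -> R).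
Implicit Types f : 'I_n -> mpoly n R.

(** The linear functional on polynomials that sends each monomial [m] to [w m]. It
    replaces the rows of the Carleman matrices: no coefficient of [cA] or [cB] has
    to be computed. *)
Definition monomial_ext w q : R := \sum_(m <- msupp q) mcoeff m q * w m.

Lemma monomial_extwE w d q : (msize q <= d)%N ->
  monomial_ext w q = \sum_(m : bmultinom n d) mcoeff m q * w m.
Proof.
move=> qd; pose I : subFinType _ := bmultinom n d.
rewrite /monomial_ext (ssrcomplements.big_mksub I) //=; first last.
- by move=> m /msize_mdeg_lt /leq_trans; apply.
- by rewrite msupp_uniq.
by rewrite big_rmcond //= => m /memN_msupp_eq0->; rewrite mul0r.
Qed.

Lemma monomial_ext_is_linear w : linear_for *%R (monomial_ext w).
Proof.
move=> a p q /=.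
pose d := maxn (msize (a *: p + q)) (maxn (msize p) (msize q)).
rewrite !(@monomial_extwE w d) /d ?leq_max ?leqnn ?orbT//.
rewrite mulr_sumr -big_split/=; apply: eq_bigr => m _.
by rewrite mcoeffD mcoeffZ mulrDl mulrA.
Qed.

HB.instance Definition _ w := GRing.isLinear.Build R (mpoly n R) R *%R
  (monomial_ext w) (monomial_ext_is_linear w).

Lemma monomial_extX w m : monomial_ext w (mpolyX R m) = w m.
Proof. by rewrite /monomial_ext msuppX big_seq1 mcoeffX eqxx mul1r. Qed.

Lemma monomial_extMX w m q d : (msize q <= d)%N ->
  monomial_ext w (mpolyX R m * q) =
  \sum_(g : bmultinom n d) mcoeff g q * w (mnm_add m g).
Proof.
move=> qd; rewrite {1}(mpolywE qd) mulr_sumr linear_sum/=.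
apply: eq_bigr => g _.
by rewrite -scalerAr linearZ/= -mpolyXD monomial_extX.
Qed.

Lemma monomial_ext_peval q (y : 'cV[R]_n) :
  monomial_ext (fun m => peval (mpolyX R m) y) q = peval q y.
Proof.
rewrite /monomial_ext /peval mevalE; apply: eq_bigr => m _.
by rewrite mevalX.
Qed.

Lemma lieX f m : lie f (mpolyX R m) =
  \sum_(j < n) (m j)%:R *: (mpolyX R (mnm_sub m (mnm1 j)) * f j).
Proof.
by apply: eq_bigr => j _; rewrite mderivX scalerAl.
Qed.

Lemma lie_is_linear f : linear (lie f).
Proof.
move=> a p q; rewrite /lie scaler_sumr -big_split/=; apply: eq_bigr => j _.
by rewrite linearP mulrDl scalerAl.
Qed.

Lemma lieM f p q : lie f (p * q) = lie f p * q + p * lie f q.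
Proof.
rewrite /lie mulr_suml mulr_sumr -big_split/=; apply: eq_bigr => j _.
by rewrite mderivM mulrDl -!mulrA [q * _]mulrC.
Qed.

Lemma peval0 q : peval q 0 = mcoeff mnm0 q.
Proof.
rewrite /peval mevalE [in RHS](mpolyE q) raddf_sum/=.
apply: eq_bigr => m _; rewrite mcoeffZ mcoeffX; congr (_ * _).
have [->|m0] := eqVneq m mnm0.
  by rewrite big1// => i _; rewrite mnm0E expr0.
have [i mi] : exists i, m i != 0%N.
  apply/existsP; rewrite -negb_forall; apply: contra m0 => /forallP mi.
  by apply/eqP/mnmP => i; rewrite mnm0E; exact/eqP.
by rewrite (bigD1 i)//= mxE expr0n (negbTE mi) mul0r.
Qed.

Lemma jacobian0E f i j : jacobian0 f i j = mcoeff (mnm1 j) (f i).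
Proof. by rewrite mxE peval0 mcoeff_deriv add0m mnm0E. Qed.

Lemma msize_vf f j : (msize (f j) <= (vf_deg f).+1)%N.
Proof.
rewrite msizeE; apply/bigmax_leqP_seq => m mq _; rewrite ltnS.
apply: leq_trans (leq_bigmax j).
exact: (@leq_bigmax_seq _ _ _ (fun m : multinom n => mdeg m)).
Qed.

Lemma is_derive_coord (x : R -> 'cV[R]_n) (t : R) (dx : 'cV[R]_n) i :
  is_derive t 1 x dx -> is_derive t 1 (fun s => x s i 0) (dx i 0).
Proof.
move=> [xd xE]; have /derivable_mxP/(_ i 0) xid := xd.
apply: DeriveDef => //.
by rewrite -xE derive_mx// mxE.
Qed.

(** Both sides are derivations in [q], so the chain rule reduces to the
    coordinates. *)
Lemma is_derive_peval f (x : R -> 'cV[R]_n) (t : R) q :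
  is_derive t 1 x (vf_eval f (x t)) ->
  is_derive t 1 (fun s => peval q (x s)) (peval (lie f q) (x t)).
Proof.
move=> xd.
pose good q := is_derive t 1 (fun s => peval q (x s)) (peval (lie f q) (x t)).
have good1 : good 1.
  rewrite /good /lie big1; last first.
    by move=> j _; rewrite -mpolyC1 mderivC mul0r.
  rewrite /peval meval0.
  under eq_fun do rewrite meval1.
  exact: is_derive_cst.
have goodX i : good (mpolyX R (mnm1 i)).
  rewrite /good.
  have -> : (fun s => peval (mpolyX R (mnm1 i)) (x s)) = fun s => x s i 0.
    by apply/funext => s; rewrite /peval mevalXU.
  have := is_derive_coord i xd; rewrite mxE.
  suff -> : lie f (mpolyX R (mnm1 i)) = f i by [].
  rewrite /lie (bigD1 i)//= big1 => [|j ji].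
    have -> : mderiv i (mpolyX R (mnm1 i)) = 1.
      rewrite mderivX mnm1E eqxx scale1r -mpolyX0; congr mpolyX.
      by apply/mnmP => k; rewrite mnmBE subnn mnm0E.
    by rewrite mul1r addr0.
  by rewrite mderivX mnm1E eq_sym (negbTE ji) scale0r mul0r.
have goodM p r : good p -> good r -> good (p * r).
  move=> gp gr; rewrite /good.
  have -> : (fun s => peval (p * r) (x s)) =
      (fun s => peval p (x s)) * (fun s => peval r (x s)).
    by apply/funext => s; rewrite /peval mevalM.
  apply: (is_derive_eq (is_deriveM gp gr)).
  by rewrite lieM /peval mevalD !mevalM addrC mulrC.
have goodXn m : good (mpolyX R m).
  rewrite mpolyXE_id; elim/big_ind : _ => // i _.
  elim: (m i) => [|k IH]; first by rewrite expr0.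
  by rewrite exprS; exact: goodM.
elim/mpolyind: q => [|c m q _ _ gq].
  rewrite /lie big1; last by move=> j _; rewrite mderiv0 mul0r.
  rewrite /peval meval0.
  under eq_fun do rewrite meval0.
  exact: is_derive_cst.
have -> : (fun s => peval (c *: mpolyX R m + q) (x s)) =
    c *: (fun s => peval (mpolyX R m) (x s)) + (fun s => peval q (x s)).
  by apply/funext => s; rewrite /peval mevalD mevalZ.
apply: (is_derive_eq (is_deriveD (is_deriveZ c (goodXn m)) gq)).
by rewrite lie_is_linear /peval mevalD mevalZ.
Qed.

End Polynomials.

(** * The row estimate for the Lie derivative *)

Section LieBound.
Variables (R : realType) (n : nat) (f : 'I_n.+1 -> mpoly n.+1 R).
Hypotheses (deg_gt1 : (1 < vf_deg f)%N)
  (f0 : forall j, mcoeff mnm0 (f j) = 0).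

Let monos := bmultinom n.+1 (vf_deg f).+1.

Lemma big_mdeg1 (F : multinom n.+1 -> R) :
  \sum_(g : monos | mdeg g == 1%N) F g = \sum_(l < n.+1) F (mnm1 l).
Proof.
have U_lt l : (mdeg (mnm1 l : multinom n.+1) < (vf_deg f).+1)%N by rewrite mdeg1 ltnW.
pose U l : monos := BMultinom (U_lt l).
rewrite (reindex_onto U (fun g => odflt ord0 [pick l | U l == g]))/=.
  apply: eq_bigl => l; rewrite mdeg1 eqxx/=.
  case: pickP => [l' /= /eqP E|/(_ l)]; last by rewrite eqxx.
  apply/eqP; have : mnm1 l' = mnm1 l :> multinom n.+1 := congr1 val E.
  by move/mnmP/(_ l); rewrite !mnm1E eqxx; case: eqP.
move=> g /mdeg1P[l /eqP gl].
case: pickP => [l' /= /eqP//|/(_ l)].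
by rewrite -val_eqE/= gl eqxx.
Qed.

Lemma log_norm_row (j : 'I_n.+1) :
  mcoeff (mnm1 j) (f j) + \sum_(l < n.+1 | l != j) `|mcoeff (mnm1 l) (f j)|
    <= mu1 f.
Proof.
under eq_bigr do rewrite -jacobian0E.
rewrite -jacobian0E /mu1 /log_norm_inf.
exact: (le_bigmax _ (fun i => jacobian0 f i i +
  \sum_(l < n.+1 | l != i) `|jacobian0 f i l|) j).
Qed.

Lemma C2_row (j : 'I_n.+1) :
  \sum_(g : monos | (2 <= mdeg g)%N) `|mcoeff g (f j)| <= C2 f.
Proof.
exact: (le_bigmax _ (fun i => \sum_(g : monos | (2 <= mdeg g)%N) `|mcoeff g (f i)|) j).
Qed.

(** With [k = mdeg m], the Lie derivative of the monomial [m] is the sum over [j]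
    of [m j] times [X^(m - e_j) * f j]. The linear part of [f j] keeps the degree
    and contributes one row of the logarithmic norm; the rest of [f j] raises the
    degree by at most [h] and contributes coefficients of total size [C2]. As the
    [m j] add up to [k], both contributions are multiplied by [k]. *)
Lemma monomial_ext_lie_le (s : multinom n.+1 -> R) (m : multinom n.+1) (w wb : R) :
  s m = w ->
  (forall m', mdeg m' = mdeg m -> `|s m'| <= w) ->
  (forall m', (mdeg m < mdeg m' <= mdeg m + (vf_deg f).-1)%N -> `|s m'| <= wb) ->
  monomial_ext s (lie f (mpolyX R m)) <=
    (mdeg m)%:R * mu1 f * w + (mdeg m)%:R * C2 f * wb.
Proof.
move=> sm sw swb; rewrite lieX linear_sum/=.
have -> : (mdeg m)%:R * mu1 f * w + (mdeg m)%:R * C2 f * wb =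
    \sum_(j < n.+1) (m j)%:R * (mu1 f * w + C2 f * wb).
  by rewrite -mulr_suml mdegE natr_sum mulrDr !mulrA.
apply: ler_sum => j _; rewrite linearZ/=.
have [->|mj] := posnP (m j); first by rewrite !mul0r.
apply: ler_wpM2l => //.
have Um : mnm_add (mnm_sub m (mnm1 j)) (mnm1 j) = m.
  apply/mnmP => k; rewrite mnmDE mnmBE mnm1E.
  by case: eqP => [<-|_]; rewrite ?subnK// subn0 addn0.
have w0 : 0 <= w by apply: le_trans (sw m erefl).
have dm g : (mdeg (mnm_add (mnm_sub m (mnm1 j)) g)).+1 = (mdeg m + mdeg g)%N.
  by rewrite -{2}Um !mdegD mdeg1 addn1 addSn.
rewrite (monomial_extMX _ _ (msize_vf f j)).
rewrite (bigID (fun g : monos => mdeg g == 1%N))/=; apply: lerD.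
  rewrite (big_mdeg1 (fun g => mcoeff g (f j) * s (mnm_add (mnm_sub m (mnm1 j)) g))).
  rewrite (bigD1 j)//= Um sm.
  apply: le_trans (ler_wpM2r w0 (log_norm_row j)).
  rewrite mulrDl lerD2l mulr_suml; apply: ler_sum => l _.
  rewrite (le_trans (ler_norm _))// normrM ler_wpM2l//; apply: sw.
  by apply: succn_inj; rewrite dm mdeg1 addn1.
have wb0 : 0 <= wb.
  apply: le_trans (swb (mnm_add m (mnm1 j)) _) => //.
  by rewrite mdegD mdeg1 leq_add2l -[(vf_deg f).-1]subn1 subn_gt0 addn1 ltnS leqnn.
apply: le_trans (ler_wpM2r wb0 (C2_row j)).
rewrite mulr_suml big_mkcond [leRHS]big_mkcond/=.
apply: ler_sum => g _.
have [g1|g1] := eqVneq (mdeg g) 1%N; first by rewrite g1.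
rewrite /=; case: ifPn => g2; last first.
  have /eqP : mdeg g = 0%N.
    by move: g1 g2; case: (mdeg g) => [|[]].
  by rewrite mdeg_eq0 => /eqP->; rewrite f0 mul0r.
rewrite (le_trans (ler_norm _))// normrM ler_wpM2l//; apply: swb.
apply/andP; split.
  by rewrite -ltnS dm -addn1 ltn_add2l; case: (mdeg g) g1 g2 => [|[]].
by rewrite -ltnS dm -addnS prednK ?(ltnW deg_gt1)// leq_add2l -ltnS bmdeg.
Qed.

End LieBound.

(** * The matrix exponential *)

Section MatrixExponential.
Variables (R : realType) (k : nat) (A : 'M[R]_k).
Implicit Types (t : R) (a b c : 'I_k).

Let K := \sum_(ab : 'I_k * 'I_k) `|A ab.1 ab.2|.

Let K_ge0 : 0 <= K. Proof. exact: sumr_ge0. Qed.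

(** Each entry of [expmx (t *: A)] is a power series in [t] with these
    coefficients, which can be differentiated termwise. *)
Definition expmx_coef a b (i : nat) : R := (A ^+ i) a b / i`!%:R.

Lemma normr_expmx_coef a b i : `|expmx_coef a b i| <= K ^+ i / i`!%:R.
Proof.
rewrite /expmx_coef normrM [`|_^-1|]ger0_norm ?invr_ge0// ler_wpM2r ?invr_ge0//.
elim: i a b => [|i IH] a b.
  by rewrite !expr0 mxE; case: eqP; rewrite ?normr1 ?normr0.
rewrite !exprS mxE (le_trans (ler_norm_sum _ _ _))//.
apply: (@le_trans _ _ (\sum_c `|A a c| * K ^+ i)).
  by apply: ler_sum => c _; rewrite normrM ler_wpM2l.
rewrite -mulr_suml ler_wpM2r ?exprn_ge0// /K -(pair_bigA _ (fun a b => `|A a b|))/=.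
by rewrite [leRHS](bigD1 a)//= lerDl sumr_ge0// => c _; rewrite sumr_ge0.
Qed.

Lemma expmx_coef_diffs a b :
  pseries_diffs (expmx_coef a b) = \sum_c (A a c *: expmx_coef c b).
Proof.
apply/funext => i; rewrite /pseries_diffs /expmx_coef fct_sumE.
rewrite factS natrM invfM mulrCA mulVKf ?pnatr_eq0//.
rewrite exprS mxE mulr_suml; apply: eq_bigr => c _.
by rewrite -mulrA.
Qed.

Lemma is_cvg_pseries_expmx a b t : cvgn (pseries (expmx_coef a b) t).
Proof.
apply: normed_cvg; apply: (@series_le_cvg _ _ (exp_coeff (K * `|t|))) => [i|i|i|].
- exact: normr_ge0.
- by apply: exp_coeff_ge0; rewrite mulr_ge0.
- rewrite /exp_coeff/= normrM normrX exprMn mulrAC ler_wpM2r ?exprn_ge0//.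
  exact: normr_expmx_coef.
- exact: is_cvg_series_exp_coeff.
Qed.

Lemma cvg_pseries_sum (I : Type) (r : seq I) (u : I -> R) (f : I -> R^nat) t :
  (forall i, cvgn (pseries (f i) t)) ->
  pseries (\sum_(i <- r) (u i *: f i)) t @ \oo -->
    \sum_(i <- r) u i * limn (pseries (f i) t).
Proof.
move=> fc.
have -> : pseries (\sum_(i <- r) (u i *: f i)) t =
    \sum_(i <- r) (u i *: pseries (f i) t).
  apply/funext => N; rewrite [in RHS]fct_sumE /pseries/= /series/=.
  under eq_bigr do rewrite fct_sumE mulr_suml.
  rewrite exchange_big/=; apply: eq_bigr => i _.
  transitivity (u i * \sum_(0 <= j < N) f i j * t ^+ j) => //.
  by rewrite mulr_sumr; apply: eq_bigr => j _; rewrite mulrA.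
elim/big_ind2 : _ => [|f1 l1 f2 l2 c1 c2|i _].
- exact: cvg_cst.
- exact: cvgD.
- exact: cvgMr (fc i).
Qed.

Lemma is_cvg_pseries_expmx_diffs a b t :
  cvgn (pseries (pseries_diffs (expmx_coef a b)) t).
Proof.
rewrite expmx_coef_diffs; apply/cvg_ex; eexists; apply: cvg_pseries_sum => c.
exact: is_cvg_pseries_expmx.
Qed.

Lemma is_cvg_pseries_expmx_diffs2 a b t :
  cvgn (pseries (pseries_diffs (pseries_diffs (expmx_coef a b))) t).
Proof.
have -> : pseries_diffs (pseries_diffs (expmx_coef a b)) =
    \sum_c (A a c *: pseries_diffs (expmx_coef c b)).
  rewrite expmx_coef_diffs; apply/funext => i.
  rewrite [in LHS]/pseries_diffs !fct_sumE mulr_sumr; apply: eq_bigr => c _.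
  by rewrite /pseries_diffs /GRing.scale/= mulrCA.
apply/cvg_ex; eexists; apply: cvg_pseries_sum => c.
exact: is_cvg_pseries_expmx_diffs.
Qed.

Lemma expmxE t a b : expmx (t *: A) a b = limn (pseries (expmx_coef a b) t).
Proof.
pose L : 'M[R]_k := \matrix_(a, b) limn (pseries (expmx_coef a b) t).
have expZ i : (t *: A) ^+ i = t ^+ i *: A ^+ i.
  elim: i => [|i IH]; first by rewrite !expr0 scale1r.
  by rewrite !exprS IH -!mulmxE -scalemxAl -scalemxAr scalerA.
have E N i j : series (fun i => (i`!%:R)^-1 *: (t *: A) ^+ i) N i j =
    pseries (expmx_coef i j) t N.
  rewrite /pseries /series/= summxE; apply: eq_bigr => l _.
  by rewrite expZ !mxE /expmx_coef mulrCA mulrC [_^-1 * _]mulrC.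
suff cL : series (fun i => (i`!%:R)^-1 *: (t *: A) ^+ i) @ \oo --> L.
  by rewrite /expmx (cvg_lim _ cL)// mxE.
apply/cvgrPdist_le => /= e e0.
near=> N; rewrite /Num.Def.normr/= mx_normrE (bigmax_le _ (ltW e0))//= => -[i j] _.
rewrite mxE [X in _ + X]mxE mxE E.
move: i j; near: N; apply: filter_forall => i; apply: filter_forall => j.
by have /cvgrPdist_le := @is_cvg_pseries_expmx i j t; apply.
Unshelve. all: by end_near. Qed.

Lemma is_derive_expmx t a b :
  is_derive t 1 (fun s => expmx (s *: A) a b) ((A *m expmx (t *: A)) a b).
Proof.
under eq_fun do rewrite expmxE.
rewrite mxE; under eq_bigr do rewrite expmxE.
have := @pseries_snd_diffs R (expmx_coef a b) (`|t| + 1) t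
  (@is_cvg_pseries_expmx _ _ _) (@is_cvg_pseries_expmx_diffs _ _ _)
  (@is_cvg_pseries_expmx_diffs2 _ _ _).
rewrite [`|_ + 1|]ger0_norm ?addr_ge0// ltrDl ltr01 => /(_ isT) H.
apply: (is_derive_eq H).
rewrite expmx_coef_diffs; apply: cvg_lim => //; apply: cvg_pseries_sum => c.
exact: is_cvg_pseries_expmx.
Qed.

Lemma expmx0 : expmx (0 *: A) = 1%:M.
Proof.
apply/matrixP => a b; rewrite expmxE; apply: cvg_lim => //.
rewrite -cvg_shiftS; apply: cvg_near_cst; near=> N.
rewrite /pseries/= /series/= big_nat_recl// expr0 /expmx_coef fact0 expr0.
rewrite invr1 !mulr1 big1 ?addr0// => i _.
by rewrite expr0n mulr0.
Unshelve. all: by end_near. Qed.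

End MatrixExponential.

(** * The gap between monomials and truncated coordinates *)

Section TruncationGap.
Variables (R : realType) (n : nat) (f : 'I_n.+1 -> mpoly n.+1 R).
Variables (D : nat) (C : carleman f D) (x0 : 'cV[R]_n.+1) (x : R -> 'cV[R]_n.+1).

Local Notation mono := (@alpha _ _ _ _ C).
Let h := (vf_deg f).-1.
Implicit Types (t : R) (m : multinom n.+1) (i j : 'I_(cdim C)).

(** The coordinates of the truncated system, extended by 0 to the monomials that
    it drops. *)
Definition truncated (t : R) (m : multinom n.+1) : R :=
  if [pick j | mono j == m] is Some j then carleman_sol C x0 t j 0 else 0.

Definition gap (t : R) (m : multinom n.+1) : R :=
  peval (mpolyX R m) (x t) - truncated t m.

Lemma truncated_alpha t j : truncated t (mono j) = carleman_sol C x0 t j 0.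
Proof.
rewrite /truncated; case: pickP => [j' /eqP|/(_ j)]; last by rewrite eqxx.
by move/(alpha_enum C).1 ->.
Qed.

Lemma alpha_mdeg j : (0 < mdeg (mono j) <= D)%N.
Proof. by apply: ((alpha_enum C).2 _).1; exists j. Qed.

Lemma truncated_over t m : (D < mdeg m)%N -> truncated t m = 0.
Proof.
move=> Dm; rewrite /truncated; case: pickP => // j /eqP E.
by have /andP[_] := alpha_mdeg j; rewrite E leqNgt Dm.
Qed.

Lemma gap_alpha t j : gap t (mono j) =
  alpha_eval C (x t) j 0 - carleman_sol C x0 t j 0.
Proof. by rewrite /gap truncated_alpha [alpha_eval _ _ _ _]mxE. Qed.

Lemma is_derive_carleman_sol t i :
  is_derive t 1 (fun s => carleman_sol C x0 s i 0)
    (\sum_j cA C i j * carleman_sol C x0 t j 0).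
Proof.
have -> : (fun s => carleman_sol C x0 s i 0) =
    \sum_j (alpha_eval C x0 j 0 *: (fun s => expmx (s *: cA C) i j)).
  apply/funext => s; rewrite fct_sumE mxE; apply: eq_bigr => j _.
  by rewrite mulrC.
apply: is_derive_eq.
  by apply: is_derive_sum => j; apply: is_deriveZ; exact: is_derive_expmx.
transitivity ((cA C *m carleman_sol C x0 t) i 0); last by rewrite mxE.
rewrite /carleman_sol mulmxA mxE; apply: eq_bigr => j _.
by rewrite mulrC.
Qed.

(** Evaluation at [x t] is itself the extension of the monomial values. *)
Lemma monomial_ext_gap t q : monomial_ext (gap t) q =
  peval q (x t) - monomial_ext (truncated t) q.
Proof.
rewrite -[in RHS]monomial_ext_peval /monomial_ext -sumrB; apply: eq_bigr => m _.
by rewrite -mulrBr.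
Qed.

(** The gap solves the full, untruncated Carleman system up to degree [D]: the
    matrix [cB] acts on the gap of a degree above [D], which is the monomial
    itself. *)
Lemma is_derive_gap t i : is_derive t 1 x (vf_eval f (x t)) ->
  is_derive t 1 (fun s => gap s (mono i))
    (monomial_ext (gap t) (lie f (mpolyX R (mono i)))).
Proof.
move=> xd.
have -> : (fun s => gap s (mono i)) =
    (fun s => peval (mpolyX R (mono i)) (x s)) -
    (fun s => carleman_sol C x0 s i 0).
  by apply/funext => s; rewrite /gap truncated_alpha.
apply: (is_derive_eq (is_deriveB (is_derive_peval _ xd)
  (is_derive_carleman_sol t i))).
rewrite monomial_ext_gap; congr (_ - _).
rewrite lie_alpha linearD !linear_sum/= [X in _ = _ + X]big1 ?addr0.
  by apply: eq_bigr => j _; rewrite linearZ/= monomial_extX truncated_alpha.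
move=> l _; rewrite linearZ/= monomial_extX truncated_over ?mulr0//.
by have /andP[] : (D < mdeg (psi (c := C) l) <= D + (vf_deg f).-1)%N
  by apply: ((psi_enum C).2 _).1; exists l.
Qed.

Hypotheses (deg_gt1 : (1 < vf_deg f)%N) (f0 : forall k, mcoeff mnm0 (f k) = 0).
Variables (T r : R).
Hypotheses (x_at0 : x 0 = x0)
  (x_sol : forall t, 0 <= t <= T -> is_derive t 1 x (vf_eval f (x t)))
  (r_ge0 : 0 <= r) (r_le1 : r <= 1)
  (x_le : forall t, 0 <= t <= T -> `|x t| <= r).

Lemma gap0 i : gap 0 (mono i) = 0.
Proof.
by rewrite gap_alpha /carleman_sol x_at0 expmx0 mul1mx subrr.
Qed.

Lemma normr_monomial_le t m : 0 <= t <= T ->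
  `|peval (mpolyX R m) (x t)| <= r ^+ mdeg m.
Proof.
move=> /x_le xr; rewrite /peval mevalX normr_prod mdegE -prodrXr.
apply: ler_prod => i _; rewrite normr_ge0/= normrX lerXn2r// ?nnegrE//.
apply: le_trans xr; rewrite [leRHS]/Num.Def.normr/= mx_normrE.
exact: (le_bigmax _ (fun ij => `|x t ij.1 ij.2|) (i, 0)).
Qed.

Lemma C2_ge0 : 0 <= C2 f.
Proof.
apply: le_trans (C2_row f ord0).
by rewrite sumr_ge0.
Qed.

Notation maj := (majorant (mu1 f) (C2 f) h D).

(** Row by row, the estimate of the Lie derivative shows that the gaps cannot
    cross a supersolution of the system of inequalities
    [H_k' >= k * mu1 * H_k + k * C2 * max_(k < l <= k + h) H_l] that dominates
    the monomials of degree above [D], and [r ^+ D.+1 * majorant] is one. The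
    small term [e * expR (L * t)] makes the inequalities strict. *)
Lemma gap_le t i : 0 <= t <= T -> `|gap t (mono i)| <=
  r ^+ D.+1 * maj (mdeg (mono i)) t.
Proof.
move=> tT.
have C_ge0 := C2_ge0.
pose L := D%:R * (`|mu1 f| + C2 f) + 1.
suff main e : 0 < e -> forall t (ib : 'I_(cdim C) * bool), 0 <= t <= T ->
    0 < r ^+ D.+1 * maj (mdeg (mono ib.1)) t + e * expR (L * t)
        - (-1) ^+ ib.2 * gap t (mono ib.1).
  apply/ler_addgt0Pr => d d0.
  pose e := d / expR (L * t).
  have e0 : 0 < e by rewrite divr_gt0 ?expR_gt0.
  have := main e e0 t (i, false) tT; have := main e e0 t (i, true) tT.
  rewrite /= expr0 expr1 mul1r mulN1r opprK /e divfK ?gt_eqF ?expR_gt0// => H1 H2.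
  by rewrite ler_norml; apply/andP; split; lra.
move=> {t i tT} e0 t ib; move: ib t.
pose u (ib : 'I_(cdim C) * bool) t :=
  r ^+ D.+1 * maj (mdeg (mono ib.1)) t + e * expR (L * t)
        - (-1) ^+ ib.2 * gap t (mono ib.1).
pose du (ib : 'I_(cdim C) * bool) t :=
  r ^+ D.+1 * majorant_slope (mu1 f) (C2 f) h D (mdeg (mono ib.1)) t
   + e * (L * expR (L * t))
   - (-1) ^+ ib.2 * monomial_ext (gap t) (lie f (mpolyX R (mono ib.1))).
apply: (@persistent_positivity _ _ u du T) => [[i' b] t tT|[i' b]|[i' b] t tT u_ge0].
- have [t0 _] := andP tT.
  have H1 := is_deriveZ (r ^+ D.+1)
    (majorant_derive (mu1 f) (C2 f) h D (mdeg (mono i')) t0).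
  have H2 := is_deriveZ e (derive_expRM L t).
  have H3 := is_deriveZ ((-1) ^+ b) (is_derive_gap i' (x_sol tT)).
  exact: (is_deriveB (is_deriveD H1 H2) H3).
- rewrite /u/= gap0 !mulr0 subr0 expR0 mulr1.
  by rewrite ltr_wpDl// mulr_ge0 ?exprn_ge0// majorant_ge0.
(* At a touching time the signed gap of [m] equals its bound, and every other
   gap is below its own bound. *)
- set m := mono i'; rewrite /u/= -/m => /eqP; rewrite subr_eq0 => /eqP touch.
  have [t0 _] := andP tT.
  have gap_small j : `|gap t (mono j)| <=
      r ^+ D.+1 * maj (mdeg (mono j)) t + e * expR (L * t).
    have := u_ge0 (j, false); have := u_ge0 (j, true).
    rewrite /u/= expr0 expr1 mul1r mulN1r => H1 H2.
    by rewrite ler_norml; apply/andP; split; lra.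
  have [m_gt0 mD] := andP (alpha_mdeg i' : (0 < mdeg m <= D)%N).
  have alphaP m' : (0 < mdeg m' <= D)%N -> exists j, mono j = m'.
    by move/((alpha_enum C).2 m').2.
  have E0 : 0 < e * expR (L * t) by rewrite mulr_gt0 ?expR_gt0.
  have rD : 0 <= r ^+ D.+1 by rewrite exprn_ge0.
  have nsgn y : `|(-1) ^+ b * y| = `|y| :> R by rewrite normrM normrX normrN1 expr1n mul1r.
  have level m' : mdeg m' = mdeg m -> `|(-1) ^+ b * gap t m'| <=
      r ^+ D.+1 * maj (mdeg m) t + e * expR (L * t).
    move=> m'm; have [j E] : exists j, mono j = m'.
      by apply: alphaP; rewrite m'm m_gt0.
    by rewrite nsgn -m'm -E; exact: gap_small.
  have above m' : (mdeg m < mdeg m' <= mdeg m + h)%N -> `|(-1) ^+ b * gap t m'| <=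
      r ^+ D.+1 * jump_majorant (mu1 f) (C2 f) h D (mdeg m) t + e * expR (L * t).
    move=> /[dup] /andP[mm' m'h] mm'h; rewrite nsgn.
    have le_jump := majorant_le_jump (mu1 f) C_ge0 mD mm'h t0.
    have [m'D|m'D] := leqP (mdeg m') D.
      have [j E] : exists j, mono j = m'.
        by apply: alphaP; rewrite m'D (leq_ltn_trans _ mm').
      rewrite -E (le_trans (gap_small j))// lerD2r ler_wpM2l// E.
      exact: le_jump.
    rewrite /gap truncated_over// subr0 (le_trans (normr_monomial_le _ tT))//.
    apply: (@le_trans _ _ (r ^+ D.+1)); first by rewrite ler_wiXn2l.
    apply: ler_wpDr; [exact: ltW|apply: ler_peMr => //].
    by move: le_jump; rewrite majorant_over.
  have := monomial_ext_lie_le deg_gt1 f0 (esym touch) level above.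
  have -> : monomial_ext (fun m' => (-1) ^+ b * gap t m') (lie f (mpolyX R m)) =
      (-1) ^+ b * monomial_ext (gap t) (lie f (mpolyX R m)).
    by rewrite /monomial_ext mulr_sumr; apply: eq_bigr => m' _; rewrite mulrCA.
  move=> le; rewrite /du/= -/m subr_gt0 (le_lt_trans le)//.
  rewrite majorant_slopeE// -subr_gt0.
  set V := maj _ t; set Vb := jump_majorant _ _ _ _ _ _.
  rewrite (_ : _ - _ = e * expR (L * t) * (L - (mdeg m)%:R * (mu1 f + C2 f))); last by ring.
  rewrite mulr_gt0// subr_gt0 /L.
  apply: (@le_lt_trans _ _ (D%:R * (`|mu1 f| + C2 f))); last by rewrite ltrDl.
  apply: (@le_trans _ _ ((mdeg m)%:R * (`|mu1 f| + C2 f))).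
    by rewrite ler_wpM2l// lerD2r ler_norm.
  by rewrite ler_wpM2r ?addr_ge0// ler_nat.
Qed.

Lemma trunc_error_le (v : 'cV[R]_(cdim C)) (t : R) : 0 <= t <= T ->
  supported_on_degree1 v ->
  trunc_error v x x0 t <= norm1 v * (r ^+ D.+1 * maj 1 t).
Proof.
move=> tT v1; rewrite /trunc_error /dotv 2!mxE -sumrB.
rewrite (le_trans (ler_norm_sum _ _ _))// /norm1 mulr_suml; apply: ler_sum => j _.
rewrite [v^T 0 j]mxE -mulrBr -gap_alpha normrM.
have [->|vj] := eqVneq (v j 0) 0; first by rewrite normr0 !mul0r.
by rewrite ler_wpM2l// -(v1 j vj); exact: gap_le.
Qed.

End TruncationGap.

(** * Rates, exponents and observables *)

Section Rate.
Variables (R : realType) (n : nat) (f : 'I_n.+1 -> mpoly n.+1 R).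

Lemma growthE : growth (mu1 f) (vf_deg f).-1 =
  mu1_neg f + (vf_deg f).-1%:R * mu1_pos f.
Proof.
rewrite /growth /stride /mu1_neg /mu1_pos.
by have [mu0|mu0] := leP (mu1 f) 0; rewrite ?mulr1n ?mul1r ?mulr0 ?addr0 ?add0r.
Qed.

Lemma ThetaE t : 0 <= t -> Theta f t = theta (mu1 f) (vf_deg f).-1 t.
Proof.
move=> t0; rewrite /Theta -growthE.
apply: integral_primitive => // s _.
exact: derivable_continuous_at (derive_expRM _ _).
Qed.

End Rate.

(** [k < (D - h) / h + 1 = D / h]; the support gap is nonnegative because [D > 0]
    makes [(D - h) / h] larger than -1. *)
Lemma support_gap_bound (R : realType) (D h : nat) : (0 < h)%N -> (0 < D)%N ->
  exists2 k : nat, support_gap R D h = k%:Z & (h * k < D)%N.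
Proof.
move=> h0 D0.
have hR : (0 : R) < h%:R by rewrite ltr0n.
have DR : (0 : R) < D%:R by rewrite ltr0n.
rewrite /support_gap; set y : R := _ / _.
have c0 : 0 <= Num.ceil y.
  by rewrite ceil_ge0 /y ltr_pdivlMr// mulN1r ltrBrDl subrr.
case: (Num.ceil y) c0 (ceilB1_lt y) => // k _ ky; exists k => //.
move: ky; rewrite /y ltr_pdivlMr// intrB mulrBl mul1r ltrBlDr subrK.
by rewrite -natrM ltr_nat mulnC.
Qed.

(** The entries of [v] are coefficients of the observable at distinct monomials;
    the bound depends on the observable only, hence not on the truncation. *)
Lemma norm1_observable (R : realType) n (f : 'I_n -> mpoly n R) D
    (C : carleman f D) (v : 'cV[R]_(cdim C)) :
  norm1 v <= \sum_(m <- msupp (observable v)) `|mcoeff m (observable v)|.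
Proof.
have coef j : mcoeff (alpha (c := C) j) (observable v) = v j 0.
  rewrite /observable raddf_sum (bigD1 j)//= mcoeffZ mcoeffX eqxx mulr1.
  rewrite big1 ?addr0// => i ij; rewrite mcoeffZ mcoeffX.
  by rewrite (inj_eq (alpha_enum C).1) (negbTE ij) mulr0.
rewrite /norm1; under eq_bigr do rewrite -coef.
move: (observable v) => g {coef}; pose F m := `|mcoeff m g|.
rewrite -(big_map (fun j => alpha (c := C) j) xpredT F).
set s := map _ _.
have s_uniq : uniq s by rewrite map_inj_uniq ?index_enum_uniq//; exact: (alpha_enum C).1.
rewrite (bigID (fun m => m \in msupp g))/= [X in _ + X]big1 ?addr0; last first.
  by move=> m; rewrite -mcoeff_eq0 /F => /eqP->; rewrite normr0.
rewrite -big_filter (perm_big [seq m <- msupp g | m \in s]); last first.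
  apply: uniq_perm; rewrite ?filter_uniq// ?msupp_uniq// => m.
  by rewrite !mem_filter andbC.
rewrite big_filter big_mkcond; apply: ler_sum => m _.
by case: ifP.
Qed.


(** * The error bound *)

Theorem corollary2 (R : realType) (n : nat) (f : 'I_n.+1 -> mpoly n.+1 R)
    (p h : nat) (hp : p = vf_deg f) (p_ge2 : (2 <= p)%N) (hh : h = p.-1)
    (f0 : vf_eval f 0 = 0)
    (x0 : 'cV[R]_n.+1) (J : set R) (x : R -> 'cV[R]_n.+1)
    (x_sol : is_solution f x0 J x)
    (T : R) (T_gt0 : 0 < T) (T_in_J : `[0, T] `<=` J)
    (r : R) (x_le_r : (sup_on T (fun t => `|x t|%R) <= r%:E)%E)
    (C : forall D : nat, carleman f D)
    (v : forall D : nat, 'cV[R]_(cdim (C D)))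
    (v_deg1 : forall D, (1 <= D)%N -> supported_on_degree1 (v D))
    (g : mpoly n.+1 R)
    (v_obs : forall D, (1 <= D)%N -> observable (v D) = g)
    (rho_gt1 : 1 < rho f T) (r_rho_lt1 : r * rho f T < 1) :
  let r_plus := Num.max r 1 in
  let gamma2 := (r * rho f T) ^+ h in
  let K2 D := norm1 (v D) * rho f T * r * r_plus ^+ h.-1 / (rho f T - 1) in
  (forall D, (1 <= D)%N ->
     (sup_on T (trunc_error (v D) x x0) <= (K2 D * gamma2 ^ support_gap R D h)%:E)%E) /\
  (fun D => sup_on T (trunc_error (v D) x x0)) @ \oo --> 0%E.
Proof.
have [_ _ _ x_at0 x_ode] := x_sol.
have x_der t : 0 <= t <= T -> is_derive t 1 x (vf_eval f (x t)).
  by move=> tT; apply: x_ode; apply: T_in_J; rewrite /= in_itv.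
have x_le t : 0 <= t <= T -> `|x t| <= r.
  move=> tT; rewrite -lee_fin; apply: le_trans x_le_r.
  by apply: ereal_sup_ubound; exists t => //; rewrite /= in_itv.
have T_ge0 := ltW T_gt0.
have zeroT : 0 <= (0 : R) <= T by rewrite lexx.
have r_ge0 : 0 <= r by apply: le_trans (x_le 0 zeroT).
move rhoE : (rho f T) rho_gt1 r_rho_lt1 => rho rho_gt1 r_rho_lt1.
have rho_gt0 : 0 < rho by exact: lt_trans rho_gt1.
(* The hypotheses [1 < rho] and [r * rho < 1] force [r < 1], so [r_plus] is 1. *)
have r_lt1 : r < 1.
  by apply: le_lt_trans r_rho_lt1; rewrite ler_peMr// ltW.
have q_ge0 : 0 <= r * rho by rewrite mulr_ge0// ltW.
have f_at0 k : mcoeff mnm0 (f k) = 0.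
  by rewrite -peval0; move/matrixP/(_ k 0): f0; rewrite !mxE.
have deg_gt1 : (1 < vf_deg f)%N by rewrite -hp.
have h_gt0 : (0 < h)%N by rewrite hh -subn1 subn_gt0.
have hE : h = (vf_deg f).-1 by rewrite hh hp.
have error_le D t : (1 <= D)%N -> 0 <= t <= T ->
    trunc_error (v D) x x0 t <= norm1 (v D) * ((r * rho) ^+ D.+1 / (rho - 1)).
  move=> D1 tT.
  have := trunc_error_le deg_gt1 f_at0 x_at0 x_der r_ge0 (ltW r_lt1) x_le tT (v_deg1 D D1).
  move/le_trans; apply.
  have norm_ge0 : 0 <= norm1 (v D) by exact: sumr_ge0.
  rewrite ler_wpM2l// exprMn -mulrA ler_wpM2l ?exprn_ge0//.
  apply: le_trans (geometric_sum_le D rho_gt1).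
  apply: le_trans (majorant1_le (mu1 f) _ (C2_ge0 f) D1 tT) _; first by rewrite -hE.
  by rewrite -ThetaE// -rhoE.
have sup_le D : (1 <= D)%N -> (sup_on T (trunc_error (v D) x x0) <=
    (norm1 (v D) * ((r * rho) ^+ D.+1 / (rho - 1)))%:E)%E.
  move=> D1; apply: ge_ereal_sup => _ [t tT <-]; rewrite lee_fin.
  by apply: error_le => //; move: tT; rewrite /= in_itv.
have rho1 : 0 < rho - 1 by rewrite subr_gt0.
split=> [D D1|].
  apply: le_trans (sup_le D D1) _; rewrite lee_fin.
  have [k -> hk] := support_gap_bound R h_gt0 D1.
  rewrite max_r ?(ltW r_lt1)// expr1n mulr1 -exprnP -exprM.
  rewrite -!mulrA ler_wpM2l ?sumr_ge0//.
  rewrite [leRHS](_ : _ = (r * rho) ^+ (h * k).+1 / (rho - 1)); last by rewrite exprS; ring.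
  rewrite ler_wpM2r ?invr_ge0 ?(ltW rho1)// ler_wiXn2l// ?(ltW r_rho_lt1)//.
  by rewrite ltnS ltnW.
pose Kg := \sum_(m <- msupp g) `|mcoeff m g|.
apply: (@squeeze_cvge _ _ _ _ (fun=> 0%E) _
  (fun D => (geometric (Kg * (r * rho) / (rho - 1)) (r * rho) D)%:E)).
- near=> D.
  have D1 : (1 <= D)%N by near: D; exact: nbhs_infty_ge.
  apply/andP; split.
    apply: (@le_trans _ _ (trunc_error (v D) x x0 0)%:E).
      by rewrite lee_fin; exact: normr_ge0.
    by apply: ereal_sup_ubound; exists 0 => //; rewrite /= in_itv/= lexx.
  apply: le_trans (sup_le D D1) _; rewrite lee_fin /=.
  rewrite [leRHS](_ : _ = Kg * ((r * rho) ^+ D.+1 / (rho - 1))); last first.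
    by rewrite exprS; ring.
  rewrite ler_wpM2r ?divr_ge0 ?exprn_ge0 ?(ltW rho1)//.
  by rewrite /Kg -(v_obs D D1); exact: norm1_observable.
- exact: cvg_cst.
- apply: cvg_EFin; first by near=> D.
  by apply: cvg_geometric; rewrite ger0_norm.
Unshelve. all: by end_near. Qed.
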